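(* Let $q$ be a prime power, let $m\le n$ and $\epsilon$ be positive integers with $m>2\epsilon$, and let $\mathbf{A}\in\mathbb{F}_q^{m\times n}$ with $\mathrm{rank}(\mathbf{A})=m$. Let $l_{q,\mathrm{opt}}$ be the optimal linear codelength of the $(\mathbf{A},\epsilon)$ function update problem over $\mathbb{F}_q$. Then $l_{q,\mathrm{opt}}=m$ if and only if $|\mathcal{I}_{\mathrm{FU}}(\mathbf{A},\epsilon)|=q^m-1$.
   Context: Vectors are column vectors and $\mathrm{wt}$ denotes Hamming weight. For the $(\mathbf{A},\epsilon)$ function update problem over $\mathbb{F}_q$, a matrix $\mathbf{H}\in\mathbb{F}_q^{l\times n}$ is called a valid encoder matrix of codelength $l$ if there exists a function $\mathfrak{D}:\mathbb{F}_q^l\times\mathbb{F}_q^m\to\mathbb{F}_q^m$ such that $\mathfrak{D}(\mathbf{H}(\mathbf{x}+\mathbf{e}),\mathbf{A}\mathbf{x})=\mathbf{A}(\mathbf{x}+\mathbf{e})$ for all $\mathbf{x},\mathbf{e}\in\mathbb{F}_q^n$ with $\mathrm{wt}(\mathbf{e})\le\epsilon$. The optimal linear codelength $l_{q,\mathrm{opt}}$ is the minimum $l$ for which a valid encoder matrix $\mathbf{H}\in\mathbb{F}_q^{l\times n}$ exists. Define $\mathcal{I}_{\mathrm{FU}}(\mathbf{A},\epsilon)=\{\mathbf{A}\mathbf{y}\;|\;\mathbf{y}\in\mathbb{F}_q^n,\ 0<\mathrm{wt}(\mathbf{y})\le 2\epsilon\}\setminus\{\mathbf{0}\}\subseteq\mathbb{F}_q^m$.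 *)

(* Defs.v *)
From mathcomp Require Import all_boot all_order all_algebra.

Set Implicit Arguments.
Unset Strict Implicit.
Unset Printing Implicit Defensive.

Import GRing.Theory.
Local Open Scope ring_scope.

Definition hamming_weight (F : finFieldType) (n : nat) (x : 'cV[F]_n) : nat :=
  #|[set i : 'I_n | x i 0 != 0]|.

(* All types involved are finite, so quantifying over decoders as finite
   functions covers every function; see valid_encoderP. *)
Definition valid_encoder (F : finFieldType) (m n l : nat) (A : 'M[F]_(m, n))
    (eps : nat) (H : 'M[F]_(l, n)) : bool :=
  [exists D : {ffun 'cV[F]_l * 'cV[F]_m -> 'cV[F]_m},
    [forall x : 'cV[F]_n, forall e : 'cV[F]_n,
      (hamming_weight e <= eps)%N ==>
        (D (H *m (x + e), A *m x) == A *m (x + e))]].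

Lemma valid_encoderP (F : finFieldType) (m n l : nat) (A : 'M[F]_(m, n))
    (eps : nat) (H : 'M[F]_(l, n)) :
  reflect
    (exists D : 'cV[F]_l -> 'cV[F]_m -> 'cV[F]_m,
       forall x e : 'cV[F]_n, (hamming_weight e <= eps)%N ->
         D (H *m (x + e)) (A *m x) = A *m (x + e))
    (valid_encoder A eps H).
Proof.
apply: (iffP existsP) => [[D /forallP hD]|[D hD]].
  exists (fun u v => D (u, v)) => x e he.
  by apply/eqP; move/forallP/(_ e)/implyP: (hD x); apply.
exists [ffun p => D p.1 p.2]; apply/forallP => x; apply/forallP => e.
by apply/implyP => he; rewrite ffunE /= hD.
Qed.

Lemma exists_valid_encoder (F : finFieldType) (m n : nat) (A : 'M[F]_(m, n))
    (eps : nat) :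
  exists l : nat, [exists H : 'M[F]_(l, n), valid_encoder A eps H].
Proof.
exists n; apply/existsP; exists 1%:M; apply/valid_encoderP.
by exists (fun u _ => A *m u) => x e _; rewrite mul1mx.
Qed.

Definition optimal_codelength (F : finFieldType) (m n : nat)
    (A : 'M[F]_(m, n)) (eps : nat) : nat :=
  ex_minn (exists_valid_encoder A eps).

Definition I_FU (F : finFieldType) (m n : nat) (A : 'M[F]_(m, n))
    (eps : nat) : {set 'cV[F]_m} :=
  [set A *m y | y : 'cV[F]_n & (0 < hamming_weight y <= 2 * eps)%N] :\ 0.

(* Main.v *)
Require Import Defs.
From mathcomp Require Import all_boot all_order all_algebra.

Set Implicit Arguments.
Unset Strict Implicit.
Unset Printing Implicit Defensive.

Import GRing.Theory.
Local Open Scope ring_scope.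

(** An encoder [H] is valid iff the image under [A] of the kernel of [H] misses
    [I_FU A eps]. As [H = A] is valid, the optimum is at most [m]. If [I_FU]
    consists of all nonzero vectors, then [ker H <= ker A] for every valid [H],
    so [H] has at least [\rank A = m] rows. If [I_FU] misses some [v != 0], it
    misses the whole line of [v], since it is closed under nonzero scaling; any
    [B] with [m - 1] rows and kernel [<v>] then gives the valid encoder [B *m A]. *)

Section HammingWeight.
Variables (F : finFieldType) (n : nat).
Implicit Types x y : 'cV[F]_n.

Lemma hamming_weight_eq0 x : (hamming_weight x == 0%N) = (x == 0).
Proof.
rewrite /hamming_weight cards_eq0; apply/eqP/eqP => [x0|->]; last first.
  by apply/setP => i; rewrite !inE mxE eqxx.
apply/matrixP => i j; rewrite ord1 mxE; apply/eqP.
by move/setP/(_ i): x0; rewrite !inE => /negbFE.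
Qed.

Lemma hamming_weightZ a x : a != 0 -> hamming_weight (a *: x) = hamming_weight x.
Proof.
by move=> a0; apply: eq_card => i; rewrite !inE mxE mulf_eq0 (negPf a0).
Qed.

Lemma hamming_weightB x y :
  (hamming_weight (x - y) <= hamming_weight x + hamming_weight y)%N.
Proof.
apply: leq_trans (leq_card_setU _ _); apply: subset_leq_card.
apply/subsetP => i; rewrite !inE !mxE; apply: contraR.
by rewrite negb_or !negbK => /andP[/eqP-> /eqP->]; rewrite subr0.
Qed.

(** Splitting the support of [y] in two leaves at most [k] positions for [x] and at most [l] for
    [z]. With [k = l = eps] it turns a vector of weight at most [2 * eps] into a difference of two
    admissible errors. *)
Lemma hamming_weight_splitB k l y : (hamming_weight y <= k + l)%N ->
  exists x z, [/\ y = x - z, (hamming_weight x <= k)%N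
                           & (hamming_weight z <= l)%N].
Proof.
rewrite /hamming_weight; set S := [set i | _] => Skl.
(* [T] is the part of the support given to [x]; it is all of [S] when [S] has at most [k]
   elements. *)
have [T TS cT] : exists2 T : {set 'I_n}, T \subset S & #|T| = minn k #|S|.
  exists [set i in take k (enum S)].
    by apply/subsetP => i; rewrite inE => /mem_take; rewrite mem_enum.
  rewrite cardsE (card_uniqP _) ?take_uniq ?enum_uniq //.
  by rewrite size_take_min -cardE.
exists (\col_i (if i \in T then y i 0 else 0)).
exists (\col_i (if i \in T then 0 else - y i 0)); split.
- apply/matrixP => i j; rewrite ord1 !mxE.
  by case: ifP => _; rewrite ?subr0 // opprK add0r.
- apply: leq_trans (_ : #|T| <= k)%N; last by rewrite cT geq_minl.
  apply: subset_leq_card; apply/subsetP => i; rewrite inE mxE.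
  by case: ifP => //; rewrite eqxx.
apply: leq_trans (_ : #|S :\: T| <= l)%N.
  apply: subset_leq_card; apply/subsetP => i; rewrite !inE mxE.
  by case: ifP => _; rewrite ?eqxx // oppr_eq0.
by rewrite cardsDS // cT leq_subLR; case: (leqP k) => //; rewrite leq_addr.
Qed.

End HammingWeight.

Section FunctionUpdate.
Variables (F : finFieldType) (m n eps : nat) (A : 'M[F]_(m, n)).

Lemma I_FUP (w : 'cV[F]_m) :
  reflect (w != 0 /\ exists2 y : 'cV[F]_n, (hamming_weight y <= 2 * eps)%N
                                         & w = A *m y)
          (w \in I_FU A eps).
Proof.
rewrite in_setD1; apply: (iffP andP) => -[w0].
  by case/imsetP => y; rewrite inE => /andP[_ wy] def_w; split=> //; exists y.
case=> y wy def_w; split=> //; apply/imsetP; exists y => //.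
rewrite inE wy andbT lt0n hamming_weight_eq0.
by apply: contraNneq w0 => y0; rewrite def_w y0 mulmx0.
Qed.

(** Scaling a preimage [y] of [w] by [a != 0] preserves its weight; the converse scales back by
    [a^-1]. *)
Lemma I_FUZ a (w : 'cV[F]_m) :
  a != 0 -> (a *: w \in I_FU A eps) = (w \in I_FU A eps).
Proof.
have impl b v : b != 0 -> v \in I_FU A eps -> b *: v \in I_FU A eps.
  move=> b0 /I_FUP[v0 [y wy def_v]]; apply/I_FUP.
  rewrite scaler_eq0 negb_or b0; split=> //; exists (b *: y).
    by rewrite hamming_weightZ.
  by rewrite -scalemxAr def_v.
move=> a0; apply/idP/idP; last exact: impl.
by move/(impl a^-1); rewrite scalerA mulVf // scale1r invr_eq0; apply.
Qed.

Lemma card_I_FU_full :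
  #|I_FU A eps| = (#|F| ^ m - 1)%N <-> (forall w, w != 0 -> w \in I_FU A eps).
Proof.
have sI0 : I_FU A eps \subset [set~ 0] by rewrite subsetDr.
have -> : (#|F| ^ m - 1)%N = #|[set~ (0 : 'cV[F]_m)]|.
  by rewrite cardsC1 card_mx muln1 subn1.
split=> [cI w w0 | full].
  suff -> : I_FU A eps = [set~ 0] by rewrite !inE.
  by apply/eqP; rewrite eqEcard sI0 cI leqnn.
apply: eq_card => w; apply/idP/idP; first exact: (subsetP sI0).
by rewrite !inE => /full; rewrite !inE.
Qed.

(** Pairs [(x, e)] and [(x', e')] give the decoder the same input when [A *m x = A *m x'] and [H]
    kills [z = x + e - (x' + e')]. Then [A *m z = A *m (e - e')], where [e - e'] has weight at most
    [2 * eps], and the required outputs agree iff [A *m z = 0]. *)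
Lemma valid_encoder_kerP l (H : 'M[F]_(l, n)) :
  reflect (forall z : 'cV[F]_n, H *m z = 0 -> A *m z \notin I_FU A eps)
          (valid_encoder A eps H).
Proof.
apply: (iffP (valid_encoderP A eps H)) => [[D hD] z Hz | kerH].
  apply/negP => /I_FUP[/eqP Az0 [y]].
  rewrite mul2n -addnn => /hamming_weight_splitB[e [e' [def_y we we']]] Azy.
  (* With [y = e - e'], the pairs [(z - y, e)] and [(0, e')] collide: [z - y + e = z + e'], [H]
     kills [z], and [A *m (z - y) = 0]. Equal outputs force [A *m z = 0]. *)
  case: Az0; have := hD (z - y) e we; have := hD 0 e' we'.
  have -> : z - y + e = z + e' by rewrite def_y opprB -addrA subrK.
  rewrite add0r mulmx0 mulmxBr -Azy subrr !mulmxDr Hz add0r => -> /eqP.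
  by rewrite -subr_eq0 opprD addrCA subrr addr0 oppr_eq0 => /eqP.
pose P u v (p : 'cV[F]_n * 'cV[F]_n) :=
  [&& (hamming_weight p.2 <= eps)%N, H *m (p.1 + p.2) == u & A *m p.1 == v].
(* The decoder answers for any pair consistent with its input; the default 0 is never reached on an
   input arising from an admissible pair. *)
exists (fun u v => if [pick p | P u v p] is Some p then A *m (p.1 + p.2) else 0).
move=> x e we; case: pickP => [[x' e'] | /(_ (x, e))]; last first.
  by rewrite /P /= we !eqxx.
case/and3P => /= we' /eqP Hxe /eqP Ax; apply/eqP.
rewrite -subr_eq0 -mulmxBr; apply: contraR (kerH (x' + e' - (x + e)) _).
  move=> nz; apply/I_FUP; split=> //; exists (e' - e).
    apply: leq_trans (hamming_weightB _ _) _.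
    by rewrite mul2n -addnn leq_add.
  by rewrite opprD addrACA mulmxDr mulmxBr Ax subrr add0r.
by rewrite mulmxBr Hxe subrr.
Qed.

Lemma valid_encoder_id : valid_encoder A eps A.
Proof. by apply/valid_encoder_kerP => z ->; rewrite !inE eqxx. Qed.

Lemma leq_rank_valid_encoder l (H : 'M[F]_(l, n)) :
    (forall w, w != 0 -> w \in I_FU A eps) ->
  valid_encoder A eps H -> (\rank A <= l)%N.
Proof.
move=> full /valid_encoder_kerP kerH.
suff /mxrankS/leq_trans: (A <= H)%MS by apply; apply: rank_leq_row.
(* The columns of [cokermx H] lie in the kernel of [H], and [A] killing all of them amounts to row
   space inclusion. *)
suff col0 j : A *m col j (cokermx H) = 0.
  rewrite submxE; apply/eqP/matrixP => i j.
  by move/matrixP/(_ i 0): (col0 j); rewrite colE mulmxA -colE !mxE.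
apply/eqP; have Hcol0 : H *m col j (cokermx H) = 0.
  by rewrite colE mulmxA mulmx_coker mul0mx.
by apply: contraNT (kerH _ Hcol0) => /full.
Qed.

Lemma exists_valid_encoder_pred (v : 'cV[F]_m) :
    v != 0 -> v \notin I_FU A eps ->
  exists H : 'M[F]_(m.-1, n), valid_encoder A eps H.
Proof.
(* The transposes adapt [cokermx] to column vectors: [B] is a square matrix with kernel the line of
   [v]. Passing to [row_base B] keeps this kernel and leaves exactly [m.-1] rows. *)
move=> v0 vI; pose B := (cokermx v^T)^T.
have rB : \rank B = m.-1.
  by rewrite mxrank_tr mxrank_coker rank_rV trmx_eq0 v0 subn1.
rewrite -rB; exists (row_base B *m A); apply/valid_encoder_kerP => z Hz.
have /sub_rVP[a /(congr1 trmx)] : ((A *m z)^T <= v^T)%MS.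
  rewrite submxE -[cokermx _]trmxK -trmx_mul trmx_eq0 -/B -[B]mulmx_base.
  by rewrite -mulmxA [_ *m (A *m z)]mulmxA Hz mulmx0.
rewrite linearZ /= !trmxK => ->.
have [-> | a0] := eqVneq a 0; first by rewrite scale0r !inE eqxx.
by rewrite I_FUZ.
Qed.

End FunctionUpdate.

Theorem theorem3 (F : finFieldType) (m n eps : nat) (A : 'M[F]_(m, n))
    (hm : (0 < m)%N) (hmn : (m <= n)%N) (heps : (0 < eps)%N)
    (hmeps : (2 * eps < m)%N) (hA : \rank A = m) :
  optimal_codelength A eps = m <-> #|I_FU A eps| = (#|F| ^ m - 1)%N.
Proof.
apply: iff_trans (iff_sym (card_I_FU_full eps A)); rewrite /optimal_codelength.
case: ex_minnP => l /existsP[H vH] l_min; split=> [lm w w0 | full].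
  apply: contraT => /(exists_valid_encoder_pred w0)[H' vH'].
  have /l_min : [exists H : 'M_(m.-1, n), valid_encoder A eps H].
    by apply/existsP; exists H'.
  (* Minimality would give [m <= m.-1], absurd since [m] is positive. *)
  by rewrite lm leqNgt prednK ?leqnn.
apply/eqP; rewrite eqn_leq -{2}hA (leq_rank_valid_encoder full vH) andbT.
by apply/l_min/existsP; exists A; apply: valid_encoder_id.
Qed.
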